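(* Let $G$ be a graph of order $n$ with minimum degree $\delta=\delta(G)$, and let $k\ge 1$ be an integer with $\delta\ge k-1$. Then $L_k(G)\le\gamma_{\times k}(G)$. In particular, if $k\le\delta$, then, writing $\delta'=\delta-k+1$, $$L_k(G)\ \le\ \left(1-\frac{\delta'}{\binom{\delta+1}{k-1}^{1/\delta'}\,(1+\delta')^{1+1/\delta'}}\right)n.$$
   Context: All graphs are finite, simple and undirected. For a vertex $v$, $N[v]$ denotes the closed neighbourhood of $v$. A vertex set $X\subseteq V(G)$ is a $k$-limited packing if $|N[v]\cap X|\le k$ for every $v\in V(G)$; $L_k(G)$ is the maximum size of a $k$-limited packing in $G$. A set $D\subseteq V(G)$ is a $k$-tuple dominating set if $|N[v]\cap D|\ge k$ for every $v\in V(G)$; the $k$-tuple domination number $\gamma_{\times k}(G)$ is the minimum size of a $k$-tuple dominating set (defined when $\delta(G)\ge k-1$). $\delta(G)$ is the minimum vertex degree. *)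

(* Defs.v *)
From HB Require Import structures.
From mathcomp Require Import all_boot all_order all_algebra.

Set Implicit Arguments.
Unset Strict Implicit.
Unset Printing Implicit Defensive.

(* A graph is a symmetric and irreflexive [e : rel T] on a [T : finType]. *)
Definition degree (T : finType) (e : rel T) (v : T) : nat := #|[set u | e v u]|.

(* The default #|T|.-1 bounds every degree of a simple graph, so this is the
   true minimum whenever T is nonempty (and 0 when T is empty). *)
Definition min_degree (T : finType) (e : rel T) : nat :=
  \big[minn/#|T|.-1]_(v : T) degree e v.

Definition closed_nbhd (T : finType) (e : rel T) (v : T) : {set T} :=
  [set u | (u == v) || e v u].

Definition limited_packing (T : finType) (e : rel T) (k : nat) (X : {set T})
  : bool :=
  [forall v, #|closed_nbhd e v :&: X| <= k].

Definition limited_packing_number (T : finType) (e : rel T) (k : nat) : nat :=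
  \max_(X : {set T} | limited_packing e k X) #|X|.

Definition tuple_dominating (T : finType) (e : rel T) (k : nat) (D : {set T})
  : bool :=
  [forall v, k <= #|closed_nbhd e v :&: D|].

(* [setT] is k-tuple dominating exactly when some set is, i.e. when T is empty
   or k <= min_degree e + 1; otherwise the value is the junk #|T|. *)
Definition tuple_domination_number (T : finType) (e : rel T) (k : nat) : nat :=
  #|[arg min_(D < [set: T] | tuple_dominating e k D) #|D|]|.

(* Main.v *)
(* For a k-limited packing X and any vertex set A, counting the pairs (x, a)
   with x in X and a in N[x] :&: A gives
     k |X| <= k |A| + \sum_(x in X) max(0, k - |N[x] :&: A|).
   If A is k-tuple dominating the defect vanishes. Otherwise average over a
   random A containing each vertex with probability 1 - q: restricting N[x] to
   a subset of d + 1 vertices, where d is the minimum degree, the expected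
   defect at x is at most 'C(d + 1, k - 1) q^(d' + 1) with d' = d - k + 1, and
   q = ('C(d + 1, k - 1) (1 + d'))^(- 1 / d') is optimal. *)
Require Import Defs.
From HB Require Import structures.
From mathcomp Require Import all_boot all_order all_algebra.
From mathcomp Require Import reals exp.

Set Implicit Arguments.
Unset Strict Implicit.
Unset Printing Implicit Defensive.

Import Order.TTheory GRing.Theory Num.Theory.
Local Open Scope ring_scope.

Lemma bin_gt_lower (n j : nat) : (j < n)%N -> (j < 'C(n, j))%N.
Proof. by move=> lt_jn; rewrite -{1}(binSn j) leq_bin2l. Qed.

(** Such [U] are the unions [M :|: V] with [V] a subset of [S :\: M] of size [j - #|M|], and
    ['C(n, i)] with [i < n] is at least [i + 1]. Later [M] is [S :&: A] and [j] is [k.-1], so the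
    left side becomes a defect. *)
Lemma card_intermediate_sets (T : finType) (M S : {set T}) (j : nat) :
  M \subset S -> (j < #|S|)%N ->
  (j.+1 - #|M| <=
     #|[set U : {set T} | [&& M \subset U, U \subset S & #|U| == j]]|)%N.
Proof.
move=> MS ltjS; have [ltjM|leMj] := ltnP j #|M|; first by rewrite (eqP ltjM).
pose D := [set V : {set T} | V \subset S :\: M & #|V| == (j - #|M|)%N].
have injD : {in D &, injective (setU M)}.
  move=> V V'; rewrite !inE !subsetD => /andP[/andP[_ dV] _] /andP[/andP[_ dV'] _].
  move=> /(congr1 (fun U : {set T} => U :\: M)); rewrite !setDUl setDv !set0U.
  by move/setDidPl: dV => ->; move/setDidPl: dV' => ->.
have cD : #|D| = 'C(#|S| - #|M|, j - #|M|) by rewrite cards_draws cardsDS.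
apply: (@leq_trans #|D|).
  by rewrite cD subSn // bin_gt_lower // ltn_sub2r // (leq_ltn_trans leMj).
rewrite -(card_in_imset injD); apply: subset_leq_card.
apply/subsetP => _ /imsetP[V + ->]; rewrite !inE subsetD.
case/andP=> /andP[VS dVM] /eqP cV.
rewrite subsetUl subUset MS VS /= cardsU setIC disjoint_setI0 // cards0 subn0.
by rewrite cV subnKC.
Qed.

Section Graph.
Variables (T : finType) (e : rel T).

Lemma closed_nbhd_sym (u v : T) : symmetric e ->
  (u \in closed_nbhd e v) = (v \in closed_nbhd e u).
Proof. by move=> e_sym; rewrite !inE eq_sym e_sym. Qed.

Lemma min_degree_le (v : T) : (min_degree e <= degree e v)%N.
Proof.
rewrite /min_degree -minEnat -leEnat.
exact: (bigmin_le_cond (T := nat) _ (P := xpredT)).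
Qed.

Lemma card_closed_nbhd (v : T) : irreflexive e ->
  #|closed_nbhd e v| = (degree e v).+1.
Proof.
move=> e_irr; rewrite /closed_nbhd /degree.
have -> : [set u | (u == v) || e v u] = v |: [set u | e v u].
  by apply/setP=> u; rewrite !inE.
by rewrite cardsU1 inE e_irr.
Qed.

(** Double counting: since [e] is symmetric, each [a] in [A] is counted [#|closed_nbhd e a :&: X|]
    times, hence at most [k] times. *)
Lemma sum_closed_nbhd_packing (k : nat) (X A : {set T}) : symmetric e ->
  limited_packing e k X ->
  (\sum_(x in X) #|closed_nbhd e x :&: A| <= k * #|A|)%N.
Proof.
move=> e_sym /forallP packX.
have cardE x (B : {set T}) :
    #|closed_nbhd e x :&: B| = (\sum_(a in B) (a \in closed_nbhd e x))%N.
  by rewrite setIC -sum1_card big_mkcond [RHS]big_mkcond /=;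
     apply: eq_bigr => a _; rewrite inE; case: (a \in B).
under eq_bigr do rewrite cardE.
rewrite exchange_big /= mulnC -sum_nat_const; apply: leq_sum => a _.
under eq_bigr do rewrite closed_nbhd_sym //.
by rewrite -cardE.
Qed.

(** Truncated subtraction plays the role of [max(0, _)]: each [x] in [X] has [k] at most
    [#|closed_nbhd e x :&: A|] plus its defect. *)
Lemma packing_defect (k : nat) (X A : {set T}) : symmetric e ->
  limited_packing e k X ->
  (k * #|X| <= k * #|A| + \sum_(x in X) (k - #|closed_nbhd e x :&: A|))%N.
Proof.
move=> e_sym packX.
apply: leq_trans (leq_add (sum_closed_nbhd_packing A e_sym packX) (leqnn _)).
rewrite -big_split /= mulnC -sum_nat_const.
by apply: leq_sum => x _; rewrite -leq_subLR.
Qed.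

Lemma packing_le_tuple_dominating (k : nat) (X D : {set T}) :
  (0 < k)%N -> symmetric e ->
  limited_packing e k X -> tuple_dominating e k D -> (#|X| <= #|D|)%N.
Proof.
move=> k_gt0 e_sym packX /forallP domD; rewrite -(leq_pmul2l k_gt0).
have := packing_defect D e_sym packX.
by rewrite big1 ?addn0 // => x _; apply/eqP; rewrite subn_eq0.
Qed.

Lemma tuple_dominating_setT (k : nat) : irreflexive e ->
  (k <= (min_degree e).+1)%N -> tuple_dominating e k setT.
Proof.
move=> e_irr le_k; apply/forallP => v; rewrite setIT card_closed_nbhd //.
by rewrite (leq_trans le_k) // ltnS min_degree_le.
Qed.

End Graph.

Section RandomSubset.
Variables (R : realType) (T : finType) (q : R).

(* The law of the random set that contains each point independently with
   probability [1 - q]. *)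
Definition subset_weight (A : {set T}) : R :=
  \prod_v (if v \in A then 1 - q else q).

Lemma subset_weight_ge0 (A : {set T}) :
  0 <= q -> q <= 1 -> 0 <= subset_weight A.
Proof. by move=> q0 q1; apply: prodr_ge0 => v _; case: ifP; rewrite ?subr_ge0. Qed.

(** Expand a product of two-term sums in which the term [1 - q] is replaced by 0 on [W]: only the
    sets missing [W] survive. The expectations below reduce to this probability. *)
Lemma sum_subset_weight_disjoint (W : {set T}) :
  \sum_(A : {set T}) subset_weight A * [disjoint W & A]%:R = q ^+ #|W|.
Proof.
transitivity (\prod_v ((if v \in W then 0 else 1 - q) + q)).
  rewrite bigA_distr; apply: eq_bigr => A _; rewrite /subset_weight.
  have [dWA|/pred0Pn[v /andP[/= vW vA]]] := boolP [disjoint W & A].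
    rewrite mulr1; apply: eq_bigr => v _; case: ifP => // vA.
    by rewrite (disjointFl dWA vA).
  by rewrite mulr0 (bigD1 v) //= vA vW mul0r.
rewrite -prodr_const [RHS]big_mkcond; apply: eq_bigr => v _.
by case: ifP; rewrite ?add0r ?subrK.
Qed.

Lemma sum_subset_weight : \sum_(A : {set T}) subset_weight A = 1.
Proof.
rewrite -[RHS](expr0 q) -(cards0 T) -sum_subset_weight_disjoint.
by apply: eq_bigr => A _; rewrite disjoints_subset sub0set mulr1.
Qed.

Lemma sum_subset_weight_card :
  \sum_(A : {set T}) subset_weight A * #|A|%:R = (1 - q) * #|T|%:R.
Proof.
(* Membership of [v] is the complement of missing [[set v]], an event of probability [q]. *)
have cardE (A : {set T}) : #|A|%:R = \sum_v (1 - [disjoint [set v] & A]%:R) :> R.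
  rewrite -sum1_card natr_sum big_mkcond /=; apply: eq_bigr => v _.
  by rewrite disjoints1; case: (v \in A); rewrite /= ?subr0 ?subrr.
under eq_bigr do rewrite cardE mulr_sumr.
rewrite exchange_big /= mulr_natr -sumr_const; apply: eq_bigr => v _.
under eq_bigr do rewrite mulrBr mulr1.
by rewrite sumrB sum_subset_weight sum_subset_weight_disjoint cards1.
Qed.

(* The defect is at most the number of [k-1]-subsets of [S] containing
   [S :&: A], and such a subset [U] works only if [A] misses [S :\: U]. *)
Lemma sum_subset_weight_defect (S : {set T}) (k : nat) :
  0 <= q -> q <= 1 -> (0 < k)%N -> (k <= #|S|)%N ->
  \sum_(A : {set T}) subset_weight A * (k - #|S :&: A|)%:R <=
    'C(#|S|, k.-1)%:R * q ^+ (#|S| - k.-1).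
Proof.
move=> q0 q1 k0 kS.
pose P := [set U : {set T} | U \subset S & #|U| == k.-1].
apply: (@le_trans _ _ (\sum_(A : {set T})
   subset_weight A * \sum_(U in P) [disjoint S :\: U & A]%:R)).
  apply: ler_sum => A _; apply: ler_wpM2l; first exact: subset_weight_ge0.
  rewrite -natr_sum ler_nat -{1}(prednK k0).
  have ltkS : (k.-1 < #|S|)%N by rewrite prednK.
  apply: leq_trans (card_intermediate_sets (subsetIl S A) ltkS) _.
  rewrite -sum1_card big_mkcond [leqRHS]big_mkcond; apply: leq_sum => U _.
  rewrite !inE; case: ifP => // /and3P[sU -> ->] /=.
  by rewrite lt0b -setI_eq0 setIDAC setD_eq0.
under eq_bigr do rewrite mulr_sumr.
rewrite exchange_big /= -cards_draws -/P mulr_natl -sumr_const.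
apply: ler_sum => U; rewrite inE => /andP[US /eqP cU].
by rewrite sum_subset_weight_disjoint cardsDS // cU.
Qed.

End RandomSubset.

Lemma limited_packing_bound (R : realType) (T : finType) (e : rel T) (k : nat)
    (X : {set T}) (q : R) :
  symmetric e -> irreflexive e -> limited_packing e k X ->
  (0 < k)%N -> (k <= (min_degree e).+1)%N -> 0 <= q -> q <= 1 ->
  #|X|%:R <= (1 - q + 'C((min_degree e).+1, k.-1)%:R
                      * q ^+ ((min_degree e).+1 - k.-1)) * #|T|%:R.
Proof.
move=> e_sym e_irr packX k0 kd q0 q1.
set d := (min_degree e).+1 in kd *; set B := 'C(d, _)%:R * _.
have B0 : 0 <= B by rewrite mulr_ge0 // exprn_ge0.
have defect x : \sum_(A : {set T})
    subset_weight q A * (k - #|closed_nbhd e x :&: A|)%:R <= B.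
  (* Trimming the neighbourhood to [d] points, here the minimum degree plus one, can only raise the
     defect and makes the bound uniform in [x]. *)
  have : (0 < #|[set S : {set T} | S \subset closed_nbhd e x & #|S| == d]|)%N.
    by rewrite cards_draws bin_gt0 card_closed_nbhd // ltnS min_degree_le.
  case/card_gt0P=> S; rewrite inE => /andP[sSN /eqP cS].
  have := sum_subset_weight_defect q0 q1 k0 (S := S); rewrite cS => /(_ kd).
  apply: le_trans; apply: ler_sum => A _.
  rewrite ler_wpM2l ?subset_weight_ge0 // ler_nat leq_sub2l //.
  by rewrite subset_leq_card // setSI.
have kR0 : 0 < k%:R :> R by rewrite ltr0n.
rewrite -(ler_pM2l kR0).
apply: (@le_trans _ _ (k%:R * ((1 - q) * #|T|%:R) + \sum_(x in X) B)).
  rewrite -sum_subset_weight_card -[leLHS]mul1r.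
  (* Total weight 1 turns [k * #|X|] into an expectation, so that the defect inequality applies to
     each [A] separately. *)
  rewrite -[X in X * _ <= _](sum_subset_weight T q).
  rewrite mulr_suml mulr_sumr.
  apply: (@le_trans _ _ (\sum_(A : {set T}) (k%:R * (subset_weight q A * #|A|%:R)
     + \sum_(x in X) subset_weight q A * (k - #|closed_nbhd e x :&: A|)%:R))).
    apply: ler_sum => A _; rewrite [X in _ <= X + _]mulrCA -mulr_sumr -mulrDr.
    rewrite ler_wpM2l ?subset_weight_ge0 // -natr_sum -!natrM -natrD ler_nat.
    exact: packing_defect.
  by rewrite big_split /= lerD2l exchange_big /=; apply: ler_sum.
rewrite sumr_const [(_ + B) * _]mulrDl [leRHS]mulrDr lerD2l -[leLHS]mulr_natr mulrCA ler_wpM2l //.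
(* A crude estimate suffices: [#|X| <= #|T| <= k * #|T|]. *)
rewrite -natrM ler_nat (leq_trans (max_card _)) //.
by rewrite leq_pmull.
Qed.

(** This [q] is the critical point, where [b * (1 + m) * q ^ m = 1]; hence
    [b * q ^ (m + 1) = q / (1 + m)] and the value is [1 - q * m / (1 + m)]. *)
Lemma minimizer_value (R : realType) (b : R) (m : nat) :
  1 <= b -> (0 < m)%N ->
  let q := ((b * (1 + m%:R)) `^ (1 / m%:R))^-1 in
  [/\ 0 <= q, q <= 1 & 1 - q + b * q ^+ m.+1 =
     1 - m%:R / (b `^ (1 / m%:R) * (1 + m%:R) `^ (1 + 1 / m%:R))].
Proof.
move=> b1 m0; set c := 1 + m%:R; set u := (b * c) `^ _ => q.
have b0 : 0 < b by apply: lt_le_trans b1.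
have c1 : 1 <= c by rewrite lerDl.
have c0 : 0 < c by apply: lt_le_trans c1.
have mR0 : m%:R != 0 :> R by rewrite pnatr_eq0 -lt0n.
have u1 : 1 <= u.
  by rewrite -[leLHS](powRr0 (b * c));
     rewrite ler_powR ?divr_ge0 ?mulr_ege1.
have u0 : 0 < u by apply: lt_le_trans u1.
have um : u ^+ m = b * c.
  by rewrite -powR_mulrn ?ltW // -powRrM divfK // powRr1 // mulr_ge0 // ltW.
split; [by rewrite invr_ge0 ltW | by rewrite invf_le1 |].
have -> : b `^ (1 / m%:R) * c `^ (1 + 1 / m%:R) = c * u.
  rewrite powRD; last by rewrite (gt_eqF c0) implybT.
  by rewrite powRr1 ?ltW // mulrCA -powRM ?ltW.
have -> : b * q ^+ m.+1 = q / c.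
  rewrite exprS exprVn um invfM mulrCA; congr (_ * _).
  by rewrite mulrA mulfV ?gt_eqF // mul1r.
have -> : m%:R = c - 1 by rewrite /c addrC addKr.
rewrite invfM mulrA mulrBl mul1r divff ?gt_eqF // -/q mulrBl mul1r.
by rewrite [c^-1 * q]mulrC opprB addrA addrAC.
Qed.

Theorem theorem6 (R : realType) (T : finType) (e : rel T)
    (e_sym : symmetric e) (e_irr : irreflexive e) (k : nat)
    (k_ge1 : (1 <= k)%N) (k_le : (k - 1 <= min_degree e)%N) :
  (limited_packing_number e k <= tuple_domination_number e k)%N /\
  ((k <= min_degree e)%N ->
   let d := min_degree e in
   let d' := (d - k + 1)%N in
   (limited_packing_number e k)%:R <=
     (1 - d'%:R / ('C(d + 1, k - 1)%:R `^ (1 / d'%:R)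
                   * (1 + d'%:R) `^ (1 + 1 / d'%:R))) * #|T|%:R :> R).
Proof.
have k_leS : (k <= (min_degree e).+1)%N by rewrite -add1n -leq_subLR.
split.
  rewrite /tuple_domination_number; case: arg_minnP => [|D domD _].
    (* The arg min starts from [setT], which must itself be dominating for the minimum to be
       genuine. *)
    exact: tuple_dominating_setT.
  by apply/bigmax_leqP => X packX; apply: packing_le_tuple_dominating packX domD.
move=> k_le_d /=; set d := min_degree e; set d' := (d - k + 1)%N.
(* The maximum is attained because the empty set is a packing. *)
have [X packX ->] : {X | limited_packing e k X & limited_packing_number e k = #|X|}.
  apply: eq_bigmax_cond; apply/card_gt0P; exists set0; apply/forallP => v.
  by rewrite setI0 cards0.
have b1 : 1 <= 'C(d + 1, k - 1)%:R :> R.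
  by rewrite ler1n bin_gt0 addn1 (leq_trans k_le).
have [|q0 q1 <-] := minimizer_value b1 (m := d'); first by rewrite /d' addn1.
(* By [k <= d] the subtraction in [d'] is not truncated, so the two exponents agree. *)
have -> : d'.+1 = (d.+1 - k.-1)%N.
  by rewrite /d' addn1 -!subSn // ?leqW // -{1}(prednK k_ge1) subSS.
rewrite addn1 subn1 in q0 q1 *; exact: (limited_packing_bound e_sym e_irr packX).
Qed.
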